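(* For any natural number $k$, the class of finite simple graphs $\{ G \mid c_2(G)\leq k \}$ is defined by forbidding a finite set of induced subgraphs; that is, there is a finite set $M$ of finite simple graphs such that, for every finite simple graph $G$, $c_2(G)\leq k$ if and only if no induced subgraph of $G$ is isomorphic to a graph in $M$.
   Context: All graphs are finite and simple. A subgraph complementation system for a graph $G=(V,E)$ is a finite collection (family) $\mathscr{C}$ of subsets of $V$ such that, for any two distinct vertices $u,v\in V$, $uv\in E$ if and only if $u$ and $v$ appear together in an odd number of sets in $\mathscr{C}$. The subgraph complementation number $c_2(G)$ is the minimum cardinality of a subgraph complementation system for $G$. *)

(* Defs.v *)
From mathcomp Require Import all_boot.
From Stdlib Require List.

Set Implicit Arguments.
Unset Strict Implicit.
Unset Printing Implicit Defensive.

(* The empty vertex set is allowed. *)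
Record sgraph := SGraph {
  vertex :> finType;
  adj : rel vertex;
  adj_sym : symmetric adj;
  adj_irr : irreflexive adj
}.

Definition induced_adj (G : sgraph) (S : {set G}) : rel {x : G | x \in S} :=
  fun x y => adj (val x) (val y).

Lemma induced_sym (G : sgraph) (S : {set G}) : symmetric (@induced_adj G S).
Proof. by move=> x y; apply: adj_sym. Qed.

Lemma induced_irr (G : sgraph) (S : {set G}) : irreflexive (@induced_adj G S).
Proof. by move=> x; apply: adj_irr. Qed.

Definition induced (G : sgraph) (S : {set G}) : sgraph :=
  SGraph (@induced_sym G S) (@induced_irr G S).

Definition isomorphic (G H : sgraph) : Prop :=
  exists f : G -> H, bijective f /\ forall x y, adj (f x) (f y) = adj x y.

(* A system is a family: the same set may be listed several times, and each
   occurrence counts, both for the parity and for the cardinality. *)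
Definition is_scs (G : sgraph) (C : seq {set G}) : bool :=
  [forall u : G, forall v : G, (u != v) ==>
     (adj u v == odd (count (fun A : {set G} => (u \in A) && (v \in A)) C))].

Definition has_scs (G : sgraph) : pred nat :=
  fun n => [exists C : n.-tuple {set G}, is_scs C].

Lemma has_scs_ex (G : sgraph) : exists n, has_scs G n.
Proof.
pose P (A : {set G}) := [exists u, exists v, adj u v && (A == [set u; v])].
exists (size (enum P)); apply/existsP; exists (in_tuple (enum P)).
apply/'forall_forallP => u v; apply/implyP => neq_uv; apply/eqP => /=.
have PE A : P A -> u \in A -> v \in A -> adj u v && (A == [set u; v]).
  case/existsP=> x /existsP[y /andP[xy /eqP->]]; rewrite !inE.
  case/orP=> /eqP Eu; case/orP=> /eqP Ev; subst u v; rewrite ?eqxx // in neq_uv *.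
    by rewrite xy.
  by rewrite adj_sym xy setUC eqxx.
rewrite (@eq_in_count _ _ (fun A => adj u v && (A == [set u; v]))); last first.
  move=> A; rewrite mem_enum => PA; apply/idP/idP; first by case/andP; apply: PE.
  by case/andP=> _ /eqP->; rewrite !inE !eqxx orbT.
case uv: (adj u v); last by rewrite (@eq_count _ _ pred0) ?count_pred0.
rewrite (@eq_count _ _ (pred1 [set u; v])) // count_uniq_mem ?enum_uniq //.
rewrite mem_enum; suff ->: [set u; v] \in P by [].
by apply/existsP; exists u; apply/existsP; exists v; rewrite uv eqxx.
Qed.

Definition c2 (G : sgraph) : nat := ex_minn (has_scs_ex G).

(* Main.v *)
(** A system of [k] sets is the same as a labelling of the vertices by vectors of
    F_2^k such that distinct vertices are adjacent iff their labels have inner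
    product 1.  Let [S] be minimal without such a labelling, and [v] in [S].  A
    labelling of [S - v] together with adjacency to [v] sorts [S - v] into
    [2^(k+1)] classes of mutual twins of the same type.  If some class has a
    vertex [w] and more than [2^k] others, then a labelling of [S - w] gives two
    of these others the same label, and [w] can be given this label too,
    contradicting the choice of [S].  Hence the size of [S] is bounded in [k]. *)
Require Import Defs.
From mathcomp Require Import all_boot.
From Stdlib Require List.

Set Implicit Arguments.
Unset Strict Implicit.
Unset Printing Implicit Defensive.

(** A subset of ['I_k] is the support of a vector of F_2^k; the parity of the intersection is the
    inner product. *)
Definition labels (G : sgraph) (k : nat) (S : {set G}) (f : G -> {set 'I_k}) :=
  {in S &, forall u v, u != v -> adj u v = odd #|f u :&: f v|}.

Definition labelled (G : sgraph) (k : nat) (S : {set G}) : bool :=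
  [exists f : {ffun G -> {set 'I_k}}, [forall u in S, forall v in S,
     (u != v) ==> (adj u v == odd #|f u :&: f v|)]].

Lemma labelledP (G : sgraph) (k : nat) (S : {set G}) :
  reflect (exists f : G -> {set 'I_k}, labels S f) (labelled k S).
Proof.
apply: (iffP existsP) => [[f fP] | [f fP]].
  exists f => u v Su Sv neq_uv; apply/eqP.
  by move/forall_inP/(_ u Su)/forall_inP/(_ v Sv)/implyP: fP; apply.
exists (finfun f); apply/forall_inP => u Su; apply/forall_inP => v Sv.
by apply/implyP => neq_uv; rewrite !ffunE fP.
Qed.

Lemma count_tuple (T : Type) (n : nat) (C : n.-tuple T) (p : pred T) :
  count p C = #|[set i | p (tnth C i)]|.
Proof.
rewrite -[X in count _ X](map_tnth_enum C) count_map -sum1_count -sum1_card.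
by rewrite big_enum_cond; apply: eq_bigl => i; rewrite !inE.
Qed.

(** Transposing the incidence matrix swaps the two notions: a label lists the indices of the sets
    that contain the vertex. *)
Lemma c2_leq_labelled (G : sgraph) (k : nat) : (c2 G <= k) = labelled k [set: G].
Proof.
rewrite /c2; case: ex_minnP => m /existsP[C CP] m_min.
apply/idP/labelledP => [le_mk | [f fP]].
  (* Empty sets change no parity, so padding brings a system of [m] sets to exactly [k]. *)
  have sizeD : size (C ++ nseq (k - m) set0) == k.
    by rewrite size_cat size_nseq size_tuple subnKC.
  pose D := Tuple sizeD; exists (fun u => [set i | u \in tnth D i]).
  move=> u v _ _ neq_uv; move/forallP/(_ u)/forallP/(_ v)/implyP: CP.
  move=> /(_ neq_uv)/eqP->.
  rewrite [in RHS](_ : _ :&: _ = [set i | (u \in tnth D i) && (v \in tnth D i)]).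
    rewrite -(count_tuple D (fun A : {set G} => (u \in A) && (v \in A))) /=.
    by rewrite count_cat count_nseq inE mul0n addn0.
  by apply/setP => i; rewrite !inE.
apply: m_min; apply/existsP; exists [tuple [set u | i \in f u] | i < k].
apply/forallP => u; apply/forallP => v; apply/implyP => neq_uv.
rewrite fP ?inE // count_tuple; apply/eqP; congr (odd #|pred_of_set _|).
by apply/setP => i; rewrite !inE tnth_mktuple !inE.
Qed.

Lemma c2_leq_embedding (G H : sgraph) (k : nat) (h : H -> G) :
    injective h -> (forall x y, adj (h x) (h y) = adj x y) ->
  (c2 H <= k) = labelled k (h @: [set: H]).
Proof.
move=> h_inj hP; rewrite c2_leq_labelled.
apply/labelledP/labelledP => [] [f fP]; last first.
  exists (f \o h) => x y _ _ neq_xy.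
  by rewrite -hP fP ?imset_f ?inE // (inj_eq h_inj).
(* The default [set0] is harmless: only vertices in the image of [h] are compared. *)
exists (fun u => oapp f set0 [pick x | h x == u]) => _ _ /imsetP[x _ ->] /imsetP[y _ ->].
have pickh z : [pick x | h x == h z] = Some z.
  by case: pickP => [x' /eqP/h_inj-> | /(_ z)] //; rewrite eqxx.
by rewrite (inj_eq h_inj) !pickh hP; apply: fP.
Qed.

Lemma labelledW (G : sgraph) (k : nat) (S T : {set G}) :
  T \subset S -> labelled k S -> labelled k T.
Proof.
move=> /subsetP sTS /labelledP[f fP]; apply/labelledP; exists f.
by move=> u v /sTS Su /sTS Sv; apply: fP.
Qed.

Lemma c2_leq_induced (G H : sgraph) (k : nat) (S : {set G}) :
  isomorphic (induced S) H -> (c2 H <= k) = labelled k S.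
Proof.
case=> f [[g fK gK] fP].
rewrite (@c2_leq_embedding G H k (val \o g)).
- congr labelled; apply/setP => u; apply/imsetP/idP => [[x _ ->] | Su].
    exact: valP.
  by exists (f (exist _ u Su)); rewrite ?inE //= fK.
- by move=> x y /val_inj /(can_inj gK).
- by move=> x y; rewrite -[RHS](congr2 _ (gK x) (gK y)) fP.
Qed.

Lemma pigeonhole (T C : finType) (c : T -> C) (A : {set T}) (m : nat) :
  #|C| * m < #|A| -> exists x, m < #|[set u in A | c u == x]|.
Proof.
move=> ltA; apply/existsP; apply: contraLR ltA.
rewrite -leqNgt => /existsPn small.
rewrite -sum1_card (partition_big c predT) //= -sum_nat_const.
apply: leq_sum => x _; rewrite sum1_card.
by have := small x; rewrite -leqNgt cardsE.
Qed.

(** Adjacency between [s] and [t] themselves is left free, so true and false twins are both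
    covered. *)
Definition twins (G : sgraph) (S : {set G}) (s t : G) :=
  {in S, forall u, u != s -> u != t -> adj s u = adj t u}.

(** Give [w] the label of [t1]. Vertices other than [t1] see no difference, by [twins]. The pair
    [w], [t1] asks for the product of [g t1] with itself; since [g t1 = g t2], this is the product
    that encodes adjacency of [t1] and [t2]. *)
Lemma labelled_twins (G : sgraph) (k : nat) (S : {set G}) (w t1 t2 : G) :
    w \in S -> t1 \in S -> t2 \in S -> w != t1 -> w != t2 -> t1 != t2 ->
    twins S w t1 -> adj w t1 = adj t1 t2 ->
  forall g : G -> {set 'I_k}, labels (S :\ w) g -> g t1 = g t2 -> labelled k S.
Proof.
move=> Sw St1 St2 w1 w2 t12 tw1 ad g gP g12.
pose g' u := if u == w then g t1 else g u.
have Dt1 : t1 \in S :\ w by rewrite in_setD1 eq_sym w1.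
have Dt2 : t2 \in S :\ w by rewrite in_setD1 eq_sym w2.
have g'w u : u \in S -> u != w -> adj w u = odd #|g t1 :&: g u|.
  move=> Su uw; have [->|u1] := eqVneq u t1; first by rewrite ad gP // -g12.
  by rewrite tw1 // gP // ?in_setD1 ?uw // eq_sym.
apply/labelledP; exists g' => u v Su Sv uv; rewrite /g'.
have [Eu|uw] := eqVneq u w; have [Ev|vw] := eqVneq v w.
- by rewrite Eu Ev eqxx in uv.
- by rewrite Eu g'w.
- by rewrite Ev adj_sym setIC g'w.
- by rewrite gP // !inE ?uw ?vw.
Qed.

(** There are [2 ^ k * 2] classes, each with at most [(2 ^ k).+1] vertices; the outer successor
    counts the deleted vertex [v]. *)
Definition obstruction_bound (k : nat) : nat := (2 ^ k * 2 * (2 ^ k).+1).+1.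

Lemma card_minimal_unlabelled (G : sgraph) (k : nat) (S : {set G}) :
  minset (fun T => ~~ labelled k T) S -> #|S| <= obstruction_bound k.
Proof.
case/minsetP=> unlabS minS; rewrite leqNgt; apply/negP => bigS.
have del w : w \in S -> labelled k (S :\ w).
  move=> Sw; apply: contraT => /minS/(_ (subsetDl _ _)) E.
  by move: Sw; rewrite -E !inE eqxx.
have [v Sv] : exists v, v \in S by apply/set0Pn; rewrite -card_gt0; apply: leq_trans bigS.
have /labelledP[f fP] := del v Sv.
pose c u := (f u, adj u v).
have : #|{: {set 'I_k} * bool}| * (2 ^ k).+1 < #|S :\ v|.
  rewrite card_prod card_bool -cardsT -powersetT card_powerset cardsT card_ord.
  by move: bigS; rewrite (cardsD1 v S) Sv.
case/(pigeonhole c) => x; set T := finset _ => bigT.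
have TP u : u \in T -> [/\ u \in S, u != v, f u = x.1 & adj u v = x.2].
  by rewrite !inE => /andP[/andP[-> ->] /eqP <-].
have twT s t : s \in T -> t \in T -> twins S s t.
  case/TP=> Ss sv fs as_ /TP[St tv ft at_] u Su us ut.
  (* [f] says nothing about [v], which is why the class also records adjacency to [v]. *)
  have [->|uv] := eqVneq u v; first by rewrite as_ at_.
  by rewrite !fP ?inE ?sv ?tv ?uv // 1?eq_sym // fs ft.
(* All labels in [T] equal [x.1], so [T] is a clique or an independent set. *)
have adT s t : s \in T -> t \in T -> s != t -> adj s t = odd #|x.1|.
  case/TP=> Ss sv fs _ /TP[St tv ft _] st.
  by rewrite fP ?inE ?sv ?tv // fs ft setIid.
have [w Tw] : exists w, w \in T by apply/set0Pn; rewrite -card_gt0; apply: leq_trans bigT.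
have [Sw _ _ _] := TP w Tw.
have /labelledP[g gP] := del w Sw.
(* [T :\ w] has more than [2 ^ k] vertices, so [g] repeats a label on it. *)
have /(pigeonhole g)[y] : #|{: {set 'I_k}}| * 1 < #|T :\ w|.
  rewrite -cardsT -powersetT card_powerset cardsT card_ord muln1.
  by move: bigT; rewrite (cardsD1 w T) Tw.
case/card_gt1P=> t1 [t2 []].
rewrite in_set => /andP[/setD1P[t1w Tt1] /eqP g1].
rewrite in_set => /andP[/setD1P[t2w Tt2] /eqP g2] t12.
have [St1 _ _ _] := TP t1 Tt1; have [St2 _ _ _] := TP t2 Tt2.
case/negP: unlabS; apply: (labelled_twins Sw St1 St2 _ _ t12 (twT _ _ Tw Tt1) _ gP).
- by rewrite eq_sym.
- by rewrite eq_sym.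
- by rewrite !adT // eq_sym.
- by rewrite g1 g2.
Qed.

(** Symmetrising and dropping loops makes every set [E] a valid graph, so that graphs on ['I_n] can
    be enumerated through all sets of pairs. *)
Definition edge_adj (n : nat) (E : {set 'I_n * 'I_n}) : rel 'I_n :=
  fun x y => (x != y) && (((x, y) \in E) || ((y, x) \in E)).

Lemma edge_adj_sym (n : nat) (E : {set 'I_n * 'I_n}) : symmetric (edge_adj E).
Proof. by move=> x y; rewrite /edge_adj eq_sym orbC. Qed.

Lemma edge_adj_irr (n : nat) (E : {set 'I_n * 'I_n}) : irreflexive (edge_adj E).
Proof. by move=> x; rewrite /edge_adj eqxx. Qed.

Definition edge_graph (n : nat) (E : {set 'I_n * 'I_n}) : sgraph :=
  SGraph (edge_adj_sym E) (edge_adj_irr E).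

Lemma isomorphic_edge_graph (G : sgraph) :
  exists E : {set 'I_#|G| * 'I_#|G|}, isomorphic G (edge_graph E).
Proof.
exists [set p | adj (enum_val p.1 : G) (enum_val p.2)], enum_rank.
split=> [|x y]; first exact: enum_rank_bij.
rewrite /= /edge_adj !inE /= !enum_rankK (adj_sym y) orbb (inj_eq enum_rank_inj).
by have [->|] := eqVneq x y; rewrite ?adj_irr.
Qed.

Lemma In_mem (T : eqType) (x : T) (s : seq T) : x \in s -> List.In x s.
Proof.
elim: s => //= y s IHs; rewrite inE => /predU1P[->|/IHs]; first by left.
by right.
Qed.

Definition small_graphs (n : nat) : seq sgraph :=
  List.flat_map
    (fun m => List.map (@edge_graph m) (enum {: {set 'I_m * 'I_m}})) (iota 0 n.+1).

Lemma In_small_graphs (n m : nat) (E : {set 'I_m * 'I_m}) :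
  m <= n -> List.In (edge_graph E) (small_graphs n).
Proof.
move=> le_mn; apply/List.in_flat_map; exists m; split.
  by apply: In_mem; rewrite mem_iota.
by apply/List.in_map/In_mem; rewrite mem_enum.
Qed.

Theorem theorem5p3 (k : nat) :
  exists M : seq sgraph, forall G : sgraph,
    (c2 G <= k) <->
    ~ (exists (S : {set G}) (H : sgraph), List.In H M /\ isomorphic (induced S) H).
Proof.
(* The list may repeat isomorphism types and contain non-minimal obstructions; it only has to be
   finite and to contain a copy of each minimal one. *)
exists (List.filter (fun H => ~~ (c2 H <= k)) (small_graphs (obstruction_bound k))) => G.
rewrite c2_leq_labelled; split=> [labG [S [H [/List.filter_In[_ nH] isoH]]] | noS].
  by case/negP: nH; rewrite (c2_leq_induced _ isoH) (labelledW (subsetT S)).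
(* A minimal unlabelled subset of [G] induces a graph of bounded order, hence a copy of a graph in
   the list. *)
apply: contraT => /(@minset_exists _ (fun T => ~~ labelled k T))[S minS _].
have [E isoE] := isomorphic_edge_graph (induced S).
case: noS; exists S, (edge_graph E); split=> //; apply/List.filter_In; split.
  by apply: In_small_graphs; rewrite card_sig; apply: card_minimal_unlabelled.
by rewrite (c2_leq_induced _ isoE); case/minsetP: minS.
Qed.
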